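(* Let $\alpha\vDash n$. For $\mathrm{StdTab}(D)$ equal to, respectively, $\mathsf{SIT}(\alpha)$, $\mathsf{SET}(\alpha)$, $\mathsf{SRIT}(\alpha)$, $\mathsf{SRET}(\alpha)$, the known $H_n(0)$-module on the $\mathbb{C}$-span of $\mathrm{StdTab}(D)$ for, respectively, the dual immaculate functions, the extended Schur functions, the row-strict dual immaculate functions, and the row-strict extended Schur functions, is precisely the diagram module $\widehat{\mathbf{N}}_{\mathrm{StdTab}(D)}$.
   Context: Generators. $H_n(0)$ is here presented by generators $\hat\pi_1,\dots,\hat\pi_{n-1}$ with relations $\hat\pi_i^2=\hat\pi_i$, $\hat\pi_i\hat\pi_j=\hat\pi_j\hat\pi_i$ for $|i-j|\ge2$, $\hat\pi_i\hat\pi_{i+1}\hat\pi_i=\hat\pi_{i+1}\hat\pi_i\hat\pi_{i+1}$. Diagram modules. Let $D$ be a diagram of $n$ boxes with a reading order (a total order on the boxes). A standard filling is a bijective assignment of $1,\dots,n$ to the boxes; $\mathrm{rw}(T)$ is the permutation given by the entries of $T$ in reading order from left to right; $s_iT$ exchanges the entries $i,i+1$ of $T$. For a nonempty set $\mathrm{StdTab}(D)$ of standard fillings and $T\in\mathrm{StdTab}(D)$, $\mathrm{Des}(T)$ is the set of $i\in\{1,\dots,n-1\}$ with $i$ to the right of $i+1$ in $\mathrm{rw}(T)$; its elements are descents. A descent $i$ of $T$ is nonattacking if $s_iT\in\mathrm{StdTab}(D)$ and attacking otherwise. $T$ has a descent in positions $(r,s)$ if $r<s$ and $\mathrm{rw}(T)_r-\mathrm{rw}(T)_s=1$.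 $\mathrm{StdTab}(D)$ is descent-compatible if whenever $T,T'\in\mathrm{StdTab}(D)$ both have a descent in positions $(r,s)$, it is attacking in $T$ if and only if it is attacking in $T'$. In that case $\widehat{\mathbf{N}}_{\mathrm{StdTab}(D)}$ is the $H_n(0)$-module on the $\mathbb{C}$-span of $\mathrm{StdTab}(D)$ with $\hat\pi_iT=T$ if $i\notin\mathrm{Des}(T)$, $\hat\pi_iT=0$ if $i$ is an attacking descent, $\hat\pi_iT=s_iT$ if $i$ is a nonattacking descent. Tableaux. $D(\alpha)$ is the left-justified array with $\alpha_i$ boxes in row $i$, rows numbered from bottom to top. $\mathsf{SIT}(\alpha)$ and $\mathsf{SRIT}(\alpha)$ both denote the set of standard fillings of $D(\alpha)$ increasing from left to right in each row and from bottom to top in the first column. $\mathsf{SET}(\alpha)$ and $\mathsf{SRET}(\alpha)$ both denote the set of standard fillings of $D(\alpha)$ increasing from left to right in each row and from bottom to top in each column. They carry different reading orders. For $\mathsf{SIT}(\alpha)$, $\mathsf{SET}(\alpha)$: rows are read from left to right, starting at the top row and proceeding downwards (so $i\in\mathrm{Des}(T)$ iff $i+1$ is strictly above $i$). For $\mathsf{SRIT}(\alpha)$, $\mathsf{SRET}(\alpha)$: rows are read from right to left, starting at the bottom row and proceeding upwards (so $i\in\mathrm{Des}(T)$ iff $i+1$ is weakly below $i$). Known modules (on the $\mathbb{C}$-span of the tableaux): - $\mathsf{SIT}(\alpha)$ (dual immaculate functions; Berg, Bergeron, Saliola, Serrano, Zabrocki): $\hat\pi_iT=T$ if $i+1$ is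 weakly below $i$; $0$ if $i$ and $i+1$ are both in the first column; $s_iT$ otherwise. - $\mathsf{SET}(\alpha)$ (extended Schur functions; Searles): $\hat\pi_iT=T$ if $i+1$ is strictly right of $i$; $0$ if $i$ and $i+1$ are in the same column; $s_iT$ if $i+1$ is strictly left of $i$. - $\mathsf{SRIT}(\alpha)$ and $\mathsf{SRET}(\alpha)$ (row-strict dual immaculate functions and row-strict extended Schur functions; Niese, Sundaram, van Willigenburg, Vega, Wang): $\hat\pi_iT=T$ if $i+1$ is strictly above $i$; $0$ if $i+1$ is immediately right of $i$ (same row, adjacent column); $s_iT$ otherwise. *)

(* Defs.v *)
From HB Require Import structures.
From mathcomp Require Import all_boot all_order all_fingroup all_algebra.
From mathcomp Require Import complex reals.

Set Implicit Arguments.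
Unset Strict Implicit.
Unset Printing Implicit Defensive.

Import GRing.Theory.
Local Open Scope ring_scope.

(* All indices are shifted down by one: the entry k in {1, ..., n} of a       *)
(* filling is the ordinal k - 1 : 'I_n, and the generator of index i in       *)
(* {1, ..., n - 1} has index i - 1 : 'I_n.-1.  Thus, for i : 'I_n.-1, the     *)
(* entries "i" and "i + 1" are ent i and entS i.                              *)

Lemma entS_subproof n (i : 'I_n.-1) : (i.+1 < n)%N.
Proof. by rewrite -ltn_predRL. Qed.

Definition ent n (i : 'I_n.-1) : 'I_n := widen_ord (leq_pred n) i.
Definition entS n (i : 'I_n.-1) : 'I_n := Ordinal (entS_subproof i).

(* A module over the algebra H_n(0), which is given by generators and         *)
(* relations, is a vector space with linear operators, one for each           *)
(* generator, that satisfy the relations.                                     *)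
Definition is_H0_module (K : fieldType) (n : nat) (V : lmodType K)
    (pi : 'I_n.-1 -> {linear V -> V}) : Prop :=
  [/\ forall i v, pi i (pi i v) = pi i v,
      forall i j : 'I_n.-1, (i.+1 < j)%N || (j.+1 < i)%N ->
        forall v, pi i (pi j v) = pi j (pi i v)
    & forall i j : 'I_n.-1, j = i.+1 :> nat ->
        forall v, pi i (pi j (pi i v)) = pi j (pi i (pi j v))].

Record readingOrder (B : Type) := ReadingOrder {
  reads :> rel B;
  _ : total reads;
  _ : antisymmetric reads;
  _ : transitive reads
}.

Section Diagrams.

Variables (n : nat) (B : finType).

Definition filling := {ffun B -> 'I_n}.

Definition standard_filling (T : filling) : bool :=
  injectiveb T && [forall k, k \in codom T].

Definition s_ (i : 'I_n.-1) (T : filling) : filling :=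
  [ffun b => tperm (ent i) (entS i) (T b)].

(* What a generator does to a basis vector T: fix it, send it to 0, or send   *)
(* it to s_i T.                                                               *)
Inductive outcome := Fix | Kill | Swap.
Definition rule := 'I_n.-1 -> filling -> outcome.

Section Diagram.

Variables (rd : readingOrder B) (S : {set filling}).

Definition rw (T : filling) : seq nat := [seq val (T b) | b <- sort rd (enum B)].

Definition Des (T : filling) : {set 'I_n.-1} :=
  [set i | (index (val (entS i)) (rw T) < index (val (ent i)) (rw T))%N].

Definition nonattacking (T : filling) (i : 'I_n.-1) : bool :=
  (i \in Des T) && (s_ i T \in S).
Definition attacking (T : filling) (i : 'I_n.-1) : bool :=
  (i \in Des T) && (s_ i T \notin S).

(* T has a descent in positions (r, s), and this descent is i. *)
Definition descent_at (T : filling) (r s : 'I_n) (i : 'I_n.-1) : bool :=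
  [&& (r < s)%N, nth 0%N (rw T) r == entS i & nth 0%N (rw T) s == ent i].

Definition descent_compatible : Prop :=
  forall (T T' : filling) (r s : 'I_n) (i i' : 'I_n.-1),
    T \in S -> T' \in S -> descent_at T r s i -> descent_at T' r s i' ->
    (attacking T i <-> attacking T' i').

Definition diagram_rule : rule := fun i T =>
  if i \notin Des T then Fix else if attacking T i then Kill else Swap.

End Diagram.

Section RuleModule.

Variables (K : fieldType) (S : {set filling}).

(* The vector space with basis S: a vector is the family of its coordinates. *)
Definition span := {ffun {T : filling | T \in S} -> K^o}.
HB.instance Definition _ := GRing.Lmodule.on span.

Definition basis_vec (T : {T : filling | T \in S}) : span :=
  [ffun U => (U == T)%:R].

(* In the last case the value is the junk 0 if s_i T is not in S; the         *)
(* predicate rule_closed below excludes this.                                 *)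
Definition rule_basis (f : rule) (i : 'I_n.-1) (T : {T : filling | T \in S}) :
    span :=
  match f i (val T) with
  | Fix => basis_vec T
  | Kill => 0
  | Swap => oapp basis_vec 0 (insub (s_ i (val T)))
  end.

Definition rule_op (f : rule) (i : 'I_n.-1) (v : span) : span :=
  \sum_T (v T : K) *: rule_basis f i T.

Lemma rule_op_is_linear (f : rule) i : linear (rule_op f i).
Proof.
move=> a u v; rewrite /rule_op scaler_sumr -big_split /=; apply: eq_bigr => T _.
by rewrite !ffunE scalerDl scalerA.
Qed.

HB.instance Definition _ (f : rule) i :=
  GRing.isLinear.Build K span span *:%R (rule_op f i) (rule_op_is_linear f i).

Definition rule_module (f : rule) (i : 'I_n.-1) : {linear span -> span} :=
  rule_op f i.

Definition rule_closed (f : rule) : Prop :=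
  forall i T, T \in S -> f i T = Swap -> s_ i T \in S.

End RuleModule.

Definition Nhat (K : fieldType) (rd : readingOrder B) (S : {set filling}) :=
  rule_module K S (diagram_rule rd S).

(* The diagram module of S is defined, the rule f defines an H_n(0)-module on *)
(* the span of S, and these two modules are equal.                            *)
Definition is_diagram_module (K : fieldType) (rd : readingOrder B)
    (S : {set filling}) (f : rule) : Prop :=
  [/\ [/\ S != set0, {in S, forall T, standard_filling T}
        & descent_compatible rd S],
      is_H0_module (Nhat K rd S),
      rule_closed S f,
      is_H0_module (rule_module K S f)
    & forall i v, rule_module K S f i v = Nhat K rd S i v].

(* P holds of the box containing i and the box containing i + 1 in T. *)
Definition located (T : filling) (i : 'I_n.-1) (P : rel B) : bool :=
  [exists b, exists b', [&& T b == ent i, T b' == entS i & P b b']].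

End Diagrams.

Definition is_composition (n : nat) (alpha : seq nat) : bool :=
  all (leq 1) alpha && (sumn alpha == n).

Section Tableaux.

Variables (n : nat) (alpha : seq nat).

(* Rows and columns are numbered from 0, rows from bottom to top. *)
Definition dbox := {i : 'I_(size alpha) & 'I_(nth 0%N alpha i)}.
Definition row (b : dbox) : nat := tag b.
Definition col (b : dbox) : nat := tagged b.

Lemma card_dbox : #|{: dbox}| = sumn alpha.
Proof.
rewrite card_tagged sumnE big_map big_enum sumnE (big_nth 0%N) big_mkord /=.
by apply: eq_bigr => i _; rewrite card_ord.
Qed.

Lemma dbox_inj (b b' : dbox) : row b = row b' -> col b = col b' -> b = b'.
Proof.
case: b b' => [i j] [i' j']; rewrite /row /col /= => /val_inj eq_i.
by case: _ / eq_i j' => j' /val_inj ->.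
Qed.

Definition down_right (b b' : dbox) : bool :=
  (row b' < row b)%N || (row b == row b') && (col b <= col b')%N.

Definition up_left (b b' : dbox) : bool :=
  (row b < row b')%N || (row b == row b') && (col b' <= col b)%N.

Lemma down_right_total : total down_right.
Proof. by move=> b b'; rewrite /down_right; case: ltngtP => //= _; exact: leq_total. Qed.

Lemma down_right_anti : antisymmetric down_right.
Proof.
move=> b b'; rewrite /down_right.
by case: ltngtP => //= eq_row le_col; apply: dbox_inj => //; apply/anti_leq.
Qed.

Lemma down_right_trans : transitive down_right.
Proof.
move=> b a c; rewrite /down_right => /orP[lt1|/andP[/eqP-> le1]].
  by case/orP=> [lt2|/andP[/eqP<- _]]; rewrite ?lt1 ?(ltn_trans lt2 lt1).
case/orP=> [->//|/andP[/eqP-> le2]].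
by rewrite eqxx (leq_trans le1 le2) orbT.
Qed.

Lemma up_left_total : total up_left.
Proof. by move=> b b'; rewrite /up_left; case: ltngtP => //= _; exact: leq_total. Qed.

Lemma up_left_anti : antisymmetric up_left.
Proof.
move=> b b'; rewrite /up_left.
by case: ltngtP => //= eq_row le_col; apply: dbox_inj => //; apply/esym/anti_leq.
Qed.

Lemma up_left_trans : transitive up_left.
Proof.
move=> b a c; rewrite /up_left => /orP[lt1|/andP[/eqP-> le1]].
  by case/orP=> [lt2|/andP[/eqP<- _]]; rewrite ?lt1 ?(ltn_trans lt1 lt2).
case/orP=> [->//|/andP[/eqP-> le2]].
by rewrite eqxx (leq_trans le2 le1) orbT.
Qed.

(* rd_down: top row first, each row from left to right.                       *)
(* rd_up: bottom row first, each row from right to left.                      *)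
Definition rd_down : readingOrder dbox :=
  ReadingOrder down_right_total down_right_anti down_right_trans.
Definition rd_up : readingOrder dbox :=
  ReadingOrder up_left_total up_left_anti up_left_trans.

Definition rows_increase (T : filling n dbox) : bool :=
  [forall b, forall b', (row b == row b') && (col b < col b')%N ==> (T b < T b')%N].

Definition col_increases (c : nat) (T : filling n dbox) : bool :=
  [forall b, forall b',
    [&& col b == c, col b' == c & (row b < row b')%N] ==> (T b < T b')%N].

Definition cols_increase (T : filling n dbox) : bool :=
  [forall b, forall b', (col b == col b') && (row b < row b')%N ==> (T b < T b')%N].

Definition SIT : {set filling n dbox} :=
  [set T | [&& standard_filling T, rows_increase T & col_increases 0 T]].

Definition SET : {set filling n dbox} :=
  [set T | [&& standard_filling T, rows_increase T & cols_increase T]].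

Definition SRIT := SIT.
Definition SRET := SET.

(* Below, b is the box of i and b' is the box of i + 1. *)

Definition SIT_rule : rule n dbox := fun i T =>
  if located T i (fun b b' => row b' <= row b)%N then Fix
  else if located T i (fun b b' => (col b == 0%N) && (col b' == 0%N)) then Kill
  else Swap.

Definition SET_rule : rule n dbox := fun i T =>
  if located T i (fun b b' => col b < col b')%N then Fix
  else if located T i (fun b b' => col b == col b') then Kill
  else Swap.

Definition rowstrict_rule : rule n dbox := fun i T =>
  if located T i (fun b b' => row b < row b')%N then Fix
  else if located T i (fun b b' => (row b' == row b) && (col b' == (col b).+1))
  then Kill
  else Swap.

Definition SRIT_rule := rowstrict_rule.
Definition SRET_rule := rowstrict_rule.

End Tableaux.

(* Main.v *)
Require Import Defs.
From HB Require Import structures.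
From mathcomp Require Import all_boot all_order all_fingroup all_algebra.
From mathcomp Require Import complex reals.
From mathcomp Require Import zify.

Set Implicit Arguments.
Unset Strict Implicit.
Unset Printing Implicit Defensive.

(* All four sets consist of the standard fillings that increase along a       *)
(* relation R on the boxes.  Exchanging i and i + 1 in such a filling gives   *)
(* another one unless R relates the box of i to the box of i + 1, so whether  *)
(* a descent is attacking depends only on these two boxes, and the diagram    *)
(* module sorts the boxes into reading order, killing the swaps of pairs in   *)
(* R.  A sorting procedure of this kind satisfies the relations of H_n(0) for *)
(* every relation R.                                                          *)

(** Let x and y be the boxes of i and i + 1 in T. Swapping two consecutive values changes no other
    comparison, so s_i T stays increasing along R unless R relates x to y ([increasing_s_]), and i
    is a descent unless x is read before y ([mem_Des]). The diagram module therefore fixes T if x is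
    read before y, kills T if R relates x to y, and swaps otherwise. This is [sort_rule], a bubble
    sort of the boxes, and [step_sort_idem], [step_sort_comm] and [step_sort_braid] give it the
    relations of H_n(0).

    By [increasing_diagram_module], each family then only needs its known rule to agree with this
    three-way choice. The geometry behind that is [SIT_consecutive_row] (i and i + 1 in one row are
    adjacent) and, for extended Schur functions, [SET_right] (strictly right means read later). *)

Section Fillings.

Variables (n : nat) (B : finType).
Implicit Types (T : filling n B) (i j : 'I_n.-1) (x y z : B).

Lemma standard_inj T : standard_filling T -> injective T.
Proof. by case/andP=> /injectiveP. Qed.

Lemma standard_onto T (k : 'I_n) : standard_filling T -> exists b, T b = k.
Proof. by case/andP=> _ /forallP/(_ k)/codomP[b ->]; exists b. Qed.

Lemma standard_s_ i T : standard_filling T -> standard_filling (s_ i T).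
Proof.
move=> stT; apply/andP; split.
  apply/injectiveP=> b b'; rewrite !ffunE => /perm_inj.
  exact: standard_inj stT _ _.
apply/forallP=> k; have [b Tb] := standard_onto (tperm (ent i) (entS i) k) stT.
by apply/codomP; exists b; rewrite ffunE Tb tpermK.
Qed.

Lemma s_ent i T x : T x = ent i -> s_ i T x = entS i.
Proof. by move=> Tx; rewrite ffunE Tx tpermL. Qed.

Lemma s_entS i T x : T x = entS i -> s_ i T x = ent i.
Proof. by move=> Tx; rewrite ffunE Tx tpermR. Qed.

Lemma s_other i T x :
  (T x != i :> nat) -> (T x != i.+1 :> nat) -> s_ i T x = T x.
Proof. by move=> Ti TSi; rewrite ffunE tpermD // eq_sym. Qed.

Lemma s_comm i j T : (i.+1 < j)%N || (j.+1 < i)%N ->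
  s_ i (s_ j T) = s_ j (s_ i T).
Proof.
move=> far; apply/ffunP=> b; rewrite !ffunE -!permM; congr (fun_of_perm _ _).
have neqs (k : 'I_n) : (k == ent i) || (k == entS i) ->
    tperm (ent j) (entS j) k = k.
  move=> ki; rewrite tpermD //; apply/negP=> /eqP kj; move: ki far; subst k;
  rewrite -!val_eqE /=; lia.
by rewrite [RHS]conjgC tpermJ !neqs ?eqxx ?orbT.
Qed.

(** Each side is a transposition conjugated by its neighbour, and both equal the transposition of i
    and i + 2. *)
Lemma s_braid i j T : j = i.+1 :> nat ->
  s_ i (s_ j (s_ i T)) = s_ j (s_ i (s_ j T)).
Proof.
move=> ji; apply/ffunP=> b; rewrite !ffunE -!permM; congr (fun_of_perm _ _).
have -> : ent j = entS i by apply: val_inj.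
have tpermE (k l : 'I_n) p : (tperm k l * p * tperm k l = p ^ tperm k l)%g.
  by rewrite conjgE tpermV mulgA.
rewrite !mulgA !tpermE !tpermJ tpermL tpermR.
by rewrite !tpermD // -val_eqE /= ?ji; lia.
Qed.

Lemma locatedE T i x y (P : rel B) : standard_filling T ->
  T x = ent i -> T y = entS i -> located T i P = P x y.
Proof.
move=> /standard_inj injT Tx Ty; apply/existsP/idP => [[b /existsP[b']]|Pxy].
  by case/and3P=> /eqP + /eqP; rewrite -Tx -Ty => /injT-> /injT->.
by exists x; apply/existsP; exists y; rewrite Tx Ty !eqxx.
Qed.

End Fillings.

(** * Operators on the span as partial maps on fillings *)

Section Step.

Variables (n : nat) (B : finType).
Implicit Types (f : rule n B) (T : filling n B) (i j : 'I_n.-1) (x y z : B).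

(** A generator sends a basis vector to a basis vector or to 0. With [None] for 0, the relations
    become equations between options, free of linear algebra. *)
Definition step f i T : option (filling n B) :=
  match f i T with Fix => Some T | Kill => None | Swap => Some (s_ i T) end.

Section Span.

Import GRing.Theory.
Local Open Scope ring_scope.

Variables (K : fieldType) (S : {set filling n B}).

(** Fillings outside [S] also go to 0; the side condition [oapp (mem S) true u] in later lemmas
    keeps this junk value out. *)
Definition span_of (u : option (filling n B)) : Defs.span K S :=
  oapp (@basis_vec n B K S) 0 (obind insub u).

Lemma span_of_val (T : {T : filling n B | T \in S}) :
  span_of (Some (val T)) = basis_vec K T.
Proof. by rewrite /span_of /= valK. Qed.

Lemma rule_op_basis f i (T : {T : filling n B | T \in S}) :
  rule_op f i (basis_vec K T) = rule_basis K f i T.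
Proof.
rewrite /rule_op (bigD1 T) //= ffunE eqxx scale1r big1 ?addr0 // => U neqU.
by rewrite ffunE (negbTE neqU) scale0r.
Qed.

Lemma rule_op_span_of f i (u : option (filling n B)) : oapp (mem S) true u ->
  rule_op f i (span_of u) = span_of (obind (step f i) u).
Proof.
case: u => [T|] /= ST; last exact: (linear0 (rule_module K S f i)).
rewrite -[T]/(val (Sub T ST : {T : filling n B | T \in S})) span_of_val.
rewrite rule_op_basis /rule_basis /step.
by case: (f i _); rewrite ?span_of_val.
Qed.

Lemma step_closed f i (u : option (filling n B)) : rule_closed S f ->
  oapp (mem S) true u -> oapp (mem S) true (obind (step f i) u).
Proof.
move=> closed; case: u => //= T ST; rewrite /step.
by case Ef: (f i T) => //=; apply: closed Ef.
Qed.

Lemma linear_span_eq (g h : {linear Defs.span K S -> Defs.span K S}) :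
  {in S, forall T, g (span_of (Some T)) = h (span_of (Some T))} -> g =1 h.
Proof.
move=> eq_gh v.
have -> : v = \sum_T (v T : K) *: basis_vec K T.
  apply/ffunP=> U; rewrite sum_ffunE (bigD1 U) //= !ffunE eqxx.
  rewrite big1 ?addr0 => [|T neqT]; first exact/esym/mulr1.
  by rewrite !ffunE eq_sym (negbTE neqT); apply: mulr0.
rewrite !linear_sum; apply: eq_bigr => T _; rewrite !linearZ.
by rewrite -span_of_val eq_gh // (valP T).
Qed.

Lemma rule_module_ext f g : (forall i, {in S, f i =1 g i}) ->
  forall i v, rule_module K S f i v = rule_module K S g i v.
Proof.
move=> eq_fg i v; rewrite /rule_module /= /rule_op; apply: eq_bigr => T _.
by rewrite /rule_basis eq_fg // (valP T).
Qed.

(** Linear maps that agree on the basis are equal, and closure keeps every intermediate filling in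
    [S], so each relation can be tested on [step]. *)
Lemma step_H0_module f : rule_closed S f ->
  (forall i, {in S, forall T, obind (step f i) (step f i T) = step f i T}) ->
  (forall i j : 'I_n.-1, (i.+1 < j)%N || (j.+1 < i)%N -> {in S, forall T,
     obind (step f i) (step f j T) = obind (step f j) (step f i T)}) ->
  (forall i j : 'I_n.-1, j = i.+1 :> nat -> {in S, forall T,
     obind (step f i) (obind (step f j) (step f i T)) =
     obind (step f j) (obind (step f i) (step f j T))}) ->
  is_H0_module (rule_module K S f).
Proof.
move=> closed idem comm braid; set pi := rule_module K S f.
have piE i u : oapp (mem S) true u ->
    pi i (span_of u) = span_of (obind (step f i) u).
  exact: rule_op_span_of.
have piT i T : T \in S -> pi i (span_of (Some T)) = span_of (step f i T).
  by move=> ST; rewrite piE.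
have clT i T : T \in S -> oapp (mem S) true (step f i T).
  exact: (step_closed _ closed (u := Some T)).
split=> [i|i j far|i j adj].
- apply: (linear_span_eq (g := pi i \o pi i)) => T ST; rewrite [LHS]/=.
  rewrite !piT // piE; last exact: clT.
  by rewrite idem.
- apply: (linear_span_eq (g := pi i \o pi j) (h := pi j \o pi i)) => T ST.
  rewrite [LHS]/= [RHS]/= !piT //.
  rewrite piE; last exact: clT.
  rewrite piE; last exact: clT.
  by rewrite comm.
apply: (linear_span_eq (g := pi i \o (pi j \o pi i))
                       (h := pi j \o (pi i \o pi j))) => T ST.
rewrite [LHS]/= [RHS]/= !piT //.
rewrite (piE j); last exact: clT.
rewrite (piE i (step f j T)); last exact: clT.
rewrite (piE i); last exact/step_closed/clT.
rewrite (piE j); last exact/step_closed/clT.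
by rewrite braid.
Qed.

Lemma eq_H0_module (V : lmodType K) (pi pi' : 'I_n.-1 -> {linear V -> V}) :
  (forall i, pi i =1 pi' i) -> is_H0_module pi -> is_H0_module pi'.
Proof.
move=> eq_pi [idem comm braid]; split=> *; rewrite -!eq_pi.
- exact: idem.
- exact: comm.
- exact: braid.
Qed.

End Span.

(** * The 0-Hecke relations for sorting with forbidden swaps *)

Section Sort.

Variables (rd : readingOrder B) (R : rel B).

Definition sort_rule : rule n B := fun i T =>
  if located T i rd then Fix else if located T i R then Kill else Swap.

Lemma step_sort i T x y : standard_filling T -> T x = ent i -> T y = entS i ->
  step sort_rule i T =
    if rd x y then Some T else if R x y then None else Some (s_ i T).
Proof.
move=> stT Tx Ty; rewrite /step /sort_rule !(locatedE _ stT Tx Ty).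
by case: ifP => // _; case: ifP.
Qed.

(** After a swap the two boxes are in reading order, by totality, so a second application fixes the
    result. *)
Lemma step_sort_idem i T : standard_filling T ->
  obind (step sort_rule i) (step sort_rule i T) = step sort_rule i T.
Proof.
move=> stT; have [x Tx] := standard_onto (ent i) stT.
have [y Ty] := standard_onto (entS i) stT.
rewrite (step_sort stT Tx Ty).
case xy: (rd x y); first by rewrite /= (step_sort stT Tx Ty) xy.
case: (R x y) => //=.
rewrite (step_sort (standard_s_ i stT) (s_entS Ty) (s_ent Tx)).
case: rd xy => /= r tot _ _ xy.
by have := tot x y; rewrite xy /= => ->.
Qed.

(** The swap of one pair leaves the boxes of the other pair in place, so the two decisions are
    independent. *)
Lemma step_sort_comm i j T : (i.+1 < j)%N || (j.+1 < i)%N ->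
  standard_filling T ->
  obind (step sort_rule i) (step sort_rule j T) =
  obind (step sort_rule j) (step sort_rule i T).
Proof.
move=> far stT; have [x Tx] := standard_onto (ent i) stT.
have [y Ty] := standard_onto (entS i) stT.
have [z Tz] := standard_onto (ent j) stT.
have [w Tw] := standard_onto (entS j) stT.
have Ui : s_ j T x = ent i /\ s_ j T y = entS i.
  by rewrite !s_other ?Tx ?Ty //=; apply/eqP; lia.
have Uj : s_ i T z = ent j /\ s_ i T w = entS j.
  by rewrite !s_other ?Tz ?Tw //=; apply/eqP; lia.
have [[Ux Uy] [Uz Uw]] := (Ui, Uj).
have Ei := step_sort stT Tx Ty; have Ej := step_sort stT Tz Tw.
have Eij := step_sort (standard_s_ j stT) Ux Uy.
have Eji := step_sort (standard_s_ i stT) Uz Uw.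
rewrite Ei Ej.
by case xy: (rd x y); case Rxy: (R x y); case zw: (rd z w); case Rzw: (R z w);
  rewrite /= ?Eij ?Eji ?Ei ?Ej ?xy ?Rxy ?zw ?Rzw // s_comm.
Qed.

(* Both words sort the three boxes of i, i + 1, i + 2 into reading order, and *)
(* each of them swaps exactly the inverted pairs: the outcome is 0 if an      *)
(* inverted pair is in R, and the sorted filling otherwise.                   *)
Lemma step_sort_braid i j T : j = i.+1 :> nat -> standard_filling T ->
  obind (step sort_rule i) (obind (step sort_rule j) (step sort_rule i T)) =
  obind (step sort_rule j) (obind (step sort_rule i) (step sort_rule j T)).
Proof.
move=> ji stT; have eij : ent j = entS i by apply: val_inj.
have [x Tx] := standard_onto (ent i) stT.
have [y Ty] := standard_onto (entS i) stT.
have [z Tz] := standard_onto (entS j) stT.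
have si a b c (U : filling n B) :
    [/\ U a = ent i, U b = entS i & U c = entS j] ->
    [/\ s_ i U b = ent i, s_ i U a = entS i & s_ i U c = entS j].
  move=> [Ua Ub Uc]; rewrite (s_ent Ua) (s_entS Ub) s_other Uc //=;
  by apply/eqP; lia.
have sj a b c (U : filling n B) :
    [/\ U a = ent i, U b = entS i & U c = entS j] ->
    [/\ s_ j U a = ent i, s_ j U c = entS i & s_ j U b = entS j].
  rewrite -eij => -[Ua Ub Uc]; rewrite (s_ent Ub) (s_entS Uc) s_other Ua //=;
  by apply/eqP; lia.
have Ei a b c U : standard_filling U ->
    [/\ U a = ent i, U b = entS i & U c = entS j] ->
    step sort_rule i U =
      if rd a b then Some U else if R a b then None else Some (s_ i U).
  by move=> stU [Ua Ub _]; apply: step_sort.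
have Ej a b c U : standard_filling U ->
    [/\ U a = ent i, U b = entS i & U c = entS j] ->
    step sort_rule j U =
      if rd b c then Some U else if R b c then None else Some (s_ j U).
  by rewrite -eij => stU [_ Ub Uc]; apply: step_sort.
have Txyz : [/\ T x = ent i, T y = entS i & T z = entS j] by [].
have st1 := standard_s_ i stT; have st2 := standard_s_ j stT.
have st12 := standard_s_ j st1; have st21 := standard_s_ i st2.
have T1 := si _ _ _ _ Txyz; have T2 := sj _ _ _ _ Txyz.
have T12 := sj _ _ _ _ T1; have T21 := si _ _ _ _ T2.
have [neq_xy neq_xz neq_yz] : [/\ x != y, x != z & y != z].
  by split; apply/eqP => /(congr1 (fun b => val (T b))); rewrite ?Tx ?Ty ?Tz /=;
    lia.
have rdN a b : a != b -> rd b a = ~~ rd a b.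
  case: rd => r tot anti _ /= neq_ab; case ab: (r a b) => /=.
    apply/negP=> ba; case/eqP: neq_ab; apply: anti.
    by rewrite ab ba.
  by have := tot a b; rewrite ab.
have rd_trans : transitive rd by case: rd.
have Nrd := (rdN _ _ neq_xy, rdN _ _ neq_xz, rdN _ _ neq_yz).
(* These two instances of transitivity rule out the two cyclic patterns among the eight truth
   assignments, leaving the six orders of three boxes. *)
have tr := @rd_trans y x z.
have trN := @rd_trans y z x; rewrite !Nrd in trN.
(* These are the values of both operators at all fillings met along the two words. Once operators
   and fillings are abstracted, each case is plain rewriting. *)
have := (Ei _ _ _ _ stT Txyz, Ej _ _ _ _ stT Txyz, Ei _ _ _ _ st1 T1,
  Ej _ _ _ _ st1 T1, Ei _ _ _ _ st2 T2, Ej _ _ _ _ st2 T2,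
  Ei _ _ _ _ st12 T12, Ej _ _ _ _ st21 T21, s_braid T ji).
clear si sj Ei Ej Txyz T1 T2 T12 T21 st1 st2 st12 st21.
move: (step _ i) (step _ j) => p q; rewrite !Nrd.
move: (s_ i (s_ j (s_ i T))) (s_ j (s_ i (s_ j T))) => U U'.
move: (s_ j (s_ i T)) (s_ i (s_ j T)) (s_ i T) (s_ j T) => Tji Tij Ti Tj E.
case xy: (rd x y) tr trN E; case xz: (rd x z); case yz: (rd y z) => //=;
  move=> tr trN; do ?[by have := tr isT isT | by have := trN isT isT];
  case: (R x y); case: (R x z); case: (R y z) => /= E.
all: by rewrite !E /= ?E /= ?E.
Qed.

End Sort.
End Step.

(** * Diagram modules of fillings increasing along a relation *)

Section IncreasingFillings.

Variables (n : nat) (B : finType) (rd : readingOrder B).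
Implicit Types (T : filling n B) (i : 'I_n.-1) (R : rel B).

Lemma mem_Des T i x y : standard_filling T -> T x = ent i -> T y = entS i ->
  (i \in Des rd T) = ~~ rd x y.
Proof.
move=> /standard_inj injT Tx Ty; rewrite inE /rw -Tx -Ty.
have inj_val : injective (fun b => val (T b)) by move=> b b' /val_inj/injT.
rewrite !(index_map inj_val).
have neq_xy : x != y.
  by apply/eqP=> /(congr1 (fun b => val (T b))); rewrite Tx Ty /=; lia.
case: rd => r tot anti tr /=.
have idx a b :
    (index a (sort r (enum B)) < index b (sort r (enum B)))%N -> r a b.
  by apply: (sorted_ltn_index tr (sort_sorted tot _)); rewrite mem_sort mem_enum.
have neq_idx : index x (sort r (enum B)) != index y (sort r (enum B)).
  apply: contraNneq neq_xy => eq_idx; apply/eqP.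
  rewrite -[x](nth_index x (s := sort r (enum B))) ?mem_sort ?mem_enum //.
  by rewrite eq_idx nth_index // mem_sort mem_enum.
case: ltngtP neq_idx => // [/idx ryx|/idx -> //] _.
by apply/esym/negP=> rxy; case/eqP: neq_xy; apply: anti; rewrite rxy ryx.
Qed.

(** No value lies strictly between i and i + 1, so only their own comparison can be reversed. *)
Lemma tperm_ltn i (k l : 'I_n) : (k < l)%N -> (k, l) != (ent i, entS i) ->
  (tperm (ent i) (entS i) k < tperm (ent i) (entS i) l)%N.
Proof.
rewrite xpair_eqE -!val_eqE /=.
have neqE (p q : 'I_n) : p <> q -> p <> q :> nat by move=> neq /val_inj.
by case: tpermP => [->|->|/neqE + /neqE]; case: tpermP => [->|->|/neqE + /neqE];
  rewrite /=; lia.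
Qed.

Definition increasing R T : bool :=
  [forall b, forall b', R b b' ==> (T b < T b')%N].

Lemma increasingP R T :
  reflect (forall b b', R b b' -> (T b < T b')%N) (increasing R T).
Proof.
apply: (iffP forallP) => [inc b b'|inc b].
  by have /forallP/(_ b')/implyP := inc b.
by apply/forallP=> b'; apply/implyP/inc.
Qed.

Lemma increasing_s_ R T i x y : standard_filling T -> increasing R T ->
  T x = ent i -> T y = entS i -> increasing R (s_ i T) = ~~ R x y.
Proof.
move=> /standard_inj injT /increasingP incT Tx Ty.
apply/increasingP/idP => [inc|nRxy b b' Rbb'].
  by apply/negP=> /inc; rewrite (s_ent Tx) (s_entS Ty) /=; lia.
rewrite !ffunE; apply: tperm_ltn; first exact: incT.
apply: contraNneq nRxy => -[]; rewrite -Tx -Ty => /injT eq_b /injT eq_b'.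
by rewrite -eq_b -eq_b'.
Qed.

Lemma increasing_diagram_module (K : fieldType) R (S : {set filling n B})
    (f : rule n B) :
    S != set0 ->
    (forall T, (T \in S) = standard_filling T && increasing R T) ->
    (forall T i x y, T \in S -> T x = ent i -> T y = entS i ->
      f i T = if rd x y then Fix else if R x y then Kill else Swap) ->
  is_diagram_module K rd S f.
Proof.
move=> S_n0 S_E f_E.
have stS T : T \in S -> standard_filling T by rewrite S_E => /andP[].
have s_S T i x y : T \in S -> T x = ent i -> T y = entS i ->
    (s_ i T \in S) = ~~ R x y.
  rewrite !S_E => /andP[stT incT] Tx Ty.
  by rewrite standard_s_ //= (increasing_s_ stT incT Tx Ty).
have attackE T i x y : T \in S -> T x = ent i -> T y = entS i ->
    attacking rd S T i = ~~ rd x y && R x y.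
  move=> ST Tx Ty.
  by rewrite /attacking (mem_Des (stS T ST) Tx Ty) (s_S T i x y) ?negbK.
have diagramE i : {in S, diagram_rule rd S i =1 f i}.
  move=> T ST; have [x Tx] := standard_onto (ent i) (stS T ST).
  have [y Ty] := standard_onto (entS i) (stS T ST).
  rewrite /diagram_rule (attackE T i x y) // (mem_Des (stS T ST) Tx Ty).
  by rewrite (f_E T i x y) //; case: (rd x y).
have sortE i : {in S, sort_rule rd R i =1 f i}.
  move=> T ST; have [x Tx] := standard_onto (ent i) (stS T ST).
  have [y Ty] := standard_onto (entS i) (stS T ST).
  rewrite (f_E T i x y) // /sort_rule.
  by rewrite !(locatedE _ (stS T ST) Tx Ty).
have closed : rule_closed S f.
  move=> i T ST; have [x Tx] := standard_onto (ent i) (stS T ST).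
  have [y Ty] := standard_onto (entS i) (stS T ST).
  by rewrite (f_E T i x y) // (s_S T i x y) //; case: (rd x y); case: (R x y).
have H0_sort : is_H0_module (rule_module K S (sort_rule rd R)).
  apply: step_H0_module => [i T ST|i T ST|i j far T ST|i j adj T ST].
  - by rewrite sortE //; apply: closed.
  - exact/step_sort_idem/stS.
  - exact/step_sort_comm/stS.
  - exact/step_sort_braid/stS.
split=> //.
- split=> // T T' r s i i' ST ST' /and3P[lt_rs Tr Ts] /and3P[_ Tr' Ts'].
  have [b0 _] := standard_onto r (stS T ST).
  have size_rd : size (sort rd (enum B)) = n.
    rewrite size_sort -cardE -[RHS]card_ord.
    rewrite -(card_codom (standard_inj (stS T ST))); apply: eq_card => k.
    by have [b <-] := standard_onto k (stS T ST); rewrite codom_f.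
  (* The box at a position does not depend on the filling, so positions (r, s) name the same two
     boxes in T and T'; these alone decide attacking. *)
  have boxE U (p k : 'I_n) : nth 0%N (rw rd U) p == k ->
      U (nth b0 (sort rd (enum B)) p) = k.
    rewrite (nth_map b0) ?size_rd // => /eqP eq_k; exact: val_inj.
  rewrite (attackE T i _ _ ST (boxE _ _ _ Ts) (boxE _ _ _ Tr)).
  by rewrite (attackE T' i' _ _ ST' (boxE _ _ _ Ts') (boxE _ _ _ Tr')).
- apply: eq_H0_module H0_sort => i v; apply: rule_module_ext => j T ST.
  by rewrite sortE ?diagramE.
- by apply: eq_H0_module H0_sort => i v; apply: rule_module_ext => j T; apply: sortE.
- by apply: rule_module_ext => j T ST; rewrite diagramE.
Qed.

End IncreasingFillings.

(** * The four families of tableaux *)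

Section Tableaux.

Local Notation row := Defs.row.
Local Notation col := Defs.col.

Variables (n : nat) (alpha : seq nat).
Implicit Types (T : filling n (dbox alpha)) (i : 'I_n.-1) (b : dbox alpha).

Definition SIT_rel : rel (dbox alpha) := fun b b' =>
  (row b == row b') && (col b < col b')%N ||
  [&& col b == 0%N, col b' == 0%N & (row b < row b')%N].

Definition SET_rel : rel (dbox alpha) := fun b b' =>
  (row b == row b') && (col b < col b')%N ||
  (col b == col b') && (row b < row b')%N.

Lemma increasing_orP (R1 R2 : rel (dbox alpha)) T :
  increasing (fun b b' => R1 b b' || R2 b b') T =
  increasing R1 T && increasing R2 T.
Proof.
apply/increasingP/andP=> [inc | [/increasingP inc1 /increasingP inc2] b b'].
  by split; apply/increasingP=> b b' Rbb'; apply: inc; rewrite Rbb' ?orbT.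
by case/orP; [apply: inc1 | apply: inc2].
Qed.

Lemma mem_SIT T :
  (T \in SIT n alpha) = standard_filling T && increasing SIT_rel T.
Proof. by rewrite inE increasing_orP. Qed.

Lemma mem_SET T :
  (T \in SET n alpha) = standard_filling T && increasing SET_rel T.
Proof. by rewrite inE increasing_orP. Qed.

Lemma SET_sub_SIT : SET n alpha \subset SIT n alpha.
Proof.
apply/subsetP=> T; rewrite mem_SET mem_SIT => /andP[-> /increasingP inc].
apply/increasingP=> b b' /orP[Rbb'|/and3P[/eqP b0 /eqP b0' lt]]; apply: inc.
  by apply/orP; left.
by rewrite /SET_rel b0 b0' lt orbT.
Qed.

Lemma SIT_row T b b' : T \in SIT n alpha -> row b = row b' ->
  (col b < col b')%N -> (T b < T b')%N.
Proof.
rewrite mem_SIT => /andP[_ /increasingP inc] eq_row lt_col.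
by apply: inc; rewrite /SIT_rel eq_row eqxx lt_col.
Qed.

Lemma SET_col T b b' : T \in SET n alpha -> col b = col b' ->
  (row b < row b')%N -> (T b < T b')%N.
Proof.
rewrite mem_SET => /andP[_ /increasingP inc] eq_col lt_row.
by apply: inc; rewrite /SET_rel eq_col eqxx lt_row orbT.
Qed.

Lemma SIT_row_le T b b' : T \in SIT n alpha -> row b = row b' ->
  (col b <= col b')%N -> (T b <= T b')%N.
Proof.
move=> ST eq_row; rewrite leq_eqVlt => /orP[/eqP eq_col|lt_col].
  by rewrite (dbox_inj eq_row eq_col).
exact/ltnW/(SIT_row ST).
Qed.

(** This is where left-justification of the diagram enters. *)
Lemma box_left b c : (c <= col b)%N ->
  exists b', row b' = row b /\ col b' = c.
Proof.
move=> le_c; have lt_c := leq_ltn_trans le_c (ltn_ord (tagged b)).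
by exists (Tagged (fun i : 'I_(size alpha) => 'I_(nth 0%N alpha i)) (Ordinal lt_c)).
Qed.

(** A box strictly between the two in their row would need an entry strictly between i and i + 1. *)
Lemma SIT_consecutive_row T i b b' : T \in SIT n alpha ->
  T b = ent i -> T b' = entS i -> row b = row b' -> col b' = (col b).+1.
Proof.
move=> ST Tb Tb' eq_row; have [le|lt] := leqP (col b') (col b).
  by have := SIT_row_le ST (esym eq_row) le; rewrite Tb Tb' /=; lia.
apply/eqP; rewrite eqn_leq lt andbT leqNgt; apply/negP=> lt2.
have [d [row_d col_d]] := box_left (ltnW lt2).
have := @SIT_row T b d ST; have := @SIT_row T d b' ST.
rewrite row_d col_d eq_row Tb Tb' ltnSn => /(_ erefl lt2) + /(_ erefl isT).
by rewrite /=; lia.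
Qed.

Lemma standard_of_inj T : #|{: dbox alpha}| = n -> injective T ->
  standard_filling T.
Proof.
move=> card_n injT; apply/andP; split; first exact/injectiveP.
by apply/forallP=> k; apply: inj_card_onto; rewrite // card_n card_ord.
Qed.

(* The witness is filled row by row, from bottom to top. *)
Lemma SET_neq0 : #|{: dbox alpha}| = n -> SET n alpha != set0.
Proof.
move=> card_n; pose lt : rel (dbox alpha) := fun b b' =>
  (row b < row b')%N || (row b == row b') && (col b < col b')%N.
(* The entry of a box is the number of boxes before it; the box itself is not counted, so this is
   below [n]. *)
have lt_card b : (#|[pred c | lt c b]| < n)%N.
  rewrite -card_n; apply: proper_card; apply/properP; split.
    exact/subset_predT.
  by exists b => //; rewrite inE /lt !ltnn andbF.
pose T : filling n (dbox alpha) := [ffun b => Ordinal (lt_card b)].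
have T_mono b b' : lt b b' -> (T b < T b')%N.
  move=> lt_bb'; rewrite !ffunE /=; apply: proper_card; apply/properP; split.
    by apply/subsetP=> c; move: lt_bb'; rewrite !inE /lt; lia.
  by exists b; rewrite inE // /lt !ltnn andbF.
apply/set0Pn; exists T; rewrite mem_SET standard_of_inj //=.
  apply/increasingP=> b b' Rbb'; apply: T_mono.
  by move: Rbb'; rewrite /SET_rel /lt; lia.
move=> b b' eqT; apply: dbox_inj; apply/eqP.
all: have := T_mono b b'; have := T_mono b' b; rewrite eqT ltnn /lt; lia.
Qed.

(** Weakly below and read later could differ only within a row, where i + 1 is the right neighbour
    of i. In a descent i + 1 is strictly above, so only the first-column clause can attack. *)
Lemma SIT_diagram (K : fieldType) : #|{: dbox alpha}| = n ->
  is_diagram_module K (rd_down alpha) (SIT n alpha) (@SIT_rule n alpha).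
Proof.
move=> card_n; apply: (increasing_diagram_module _ _ mem_SIT).
  have /set0Pn[T ST] := SET_neq0 card_n; apply/set0Pn; exists T.
  exact: (subsetP SET_sub_SIT).
move=> T i b b' ST Tb Tb'; have stT : standard_filling T.
  by move: ST; rewrite mem_SIT => /andP[].
have cons := SIT_consecutive_row ST Tb Tb'.
rewrite /SIT_rule !(locatedE _ stT Tb Tb') /= /down_right /SIT_rel.
case: ltngtP cons => //= [lt _|-> /(_ erefl) ->]; last by rewrite leqnSn.
by rewrite !andbT.
Qed.

(** In a descent i + 1 is weakly below i, whereas column conditions relate a box to a higher one.
    Hence only rows attack, which serves both row-strict families at once. *)
Lemma rowstrict_diagram (K : fieldType) (S : {set filling n (dbox alpha)})
    (R : rel (dbox alpha)) :
    S != set0 -> S \subset SIT n alpha ->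
    (forall T, (T \in S) = standard_filling T && increasing R T) ->
    (forall b b', (row b' <= row b)%N ->
      R b b' = (row b == row b') && (col b < col b')%N) ->
  is_diagram_module K (rd_up alpha) S (@rowstrict_rule n alpha).
Proof.
move=> S_n0 /subsetP S_SIT S_E R_E.
apply: (increasing_diagram_module _ S_n0 S_E) => T i b b' ST Tb Tb'.
have stT : standard_filling T by move: ST; rewrite S_E => /andP[].
have cons := SIT_consecutive_row (S_SIT _ ST) Tb Tb'.
rewrite /rowstrict_rule !(locatedE _ stT Tb Tb') /= /up_left.
case: ltnP => //= le_row; rewrite R_E // eq_sym.
case: eqP cons => //= -> /(_ erefl) ->.
by rewrite eqxx ltnn ltnSn.
Qed.

Lemma SRIT_diagram (K : fieldType) : #|{: dbox alpha}| = n ->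
  is_diagram_module K (rd_up alpha) (SRIT n alpha) (@SRIT_rule n alpha).
Proof.
move=> card_n; apply: (rowstrict_diagram _ _ _ mem_SIT) => // [|b b' le_row].
  have /set0Pn[T ST] := SET_neq0 card_n; apply/set0Pn; exists T.
  exact: (subsetP SET_sub_SIT).
by rewrite /SIT_rel (ltnNge (row b)) le_row !andbF orbF.
Qed.

Lemma SRET_diagram (K : fieldType) : #|{: dbox alpha}| = n ->
  is_diagram_module K (rd_up alpha) (SRET n alpha) (@SRET_rule n alpha).
Proof.
move=> card_n; apply: (rowstrict_diagram _ (SET_neq0 card_n) SET_sub_SIT mem_SET).
by move=> b b' le_row; rewrite /SET_rel (ltnNge (row b)) le_row !andbF orbF.
Qed.

(* If the two sides differed, the box in the row of the higher and in the     *)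
(* column of the lefter of b, b' would be bounded by one of i, i + 1 along    *)
(* its row and by the other along its column, which leaves it no entry.       *)
Lemma SET_right T i b b' : T \in SET n alpha ->
  T b = ent i -> T b' = entS i -> (col b < col b')%N = down_right b b'.
Proof.
move=> ST Tb Tb'; have SIT_T := subsetP SET_sub_SIT T ST.
have cons := SIT_consecutive_row SIT_T Tb Tb'; rewrite /down_right.
case: (ltngtP (row b') (row b)) cons => [lt_row _|lt_row _|-> /(_ erefl) ->] /=.
- rewrite ltnNge; apply/negP=> le_col.
  have [d [row_d col_d]] := box_left le_col.
  have := @SET_col T b' d ST (esym col_d); rewrite row_d => /(_ lt_row).
  have := @SIT_row_le T d b SIT_T row_d; rewrite col_d => /(_ le_col).
  by rewrite Tb Tb' /=; lia.
- apply/negbTE/negP=> lt_col; have [d [row_d col_d]] := box_left (ltnW lt_col).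
  have := @SET_col T b d ST (esym col_d); rewrite row_d => /(_ lt_row).
  have := @SIT_row T d b' SIT_T row_d; rewrite col_d => /(_ lt_col).
  by rewrite Tb Tb' /=; lia.
- by rewrite leqnSn ltnSn.
Qed.

Lemma SET_diagram (K : fieldType) : #|{: dbox alpha}| = n ->
  is_diagram_module K (rd_down alpha) (SET n alpha) (@SET_rule n alpha).
Proof.
move=> card_n; apply: (increasing_diagram_module _ (SET_neq0 card_n) mem_SET).
move=> T i b b' ST Tb Tb'.
have stT : standard_filling T by move: ST; rewrite mem_SET => /andP[].
rewrite /SET_rule !(locatedE _ stT Tb Tb') (SET_right ST Tb Tb') /=.
case: ifPn => //; rewrite negb_or -leqNgt => /andP[le_row].
rewrite /SET_rel; case: (ltngtP (row b) (row b')) le_row => //= [_ _ _|_ _].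
  by rewrite andbT.
(* Same row with i + 1 to the left of i: both rules answer [Swap]. *)
by rewrite -ltnNge => lt_col; rewrite (gtn_eqF lt_col) ltnNge (ltnW lt_col).
Qed.

End Tableaux.

Theorem theorem7p3 (R : realType) (n : nat) (alpha : seq nat)
    (halpha : is_composition n alpha) :
  [/\ is_diagram_module R[i] (rd_down alpha) (SIT n alpha) (@SIT_rule n alpha),
      is_diagram_module R[i] (rd_down alpha) (SET n alpha) (@SET_rule n alpha),
      is_diagram_module R[i] (rd_up alpha) (SRIT n alpha) (@SRIT_rule n alpha)
    & is_diagram_module R[i] (rd_up alpha) (SRET n alpha) (@SRET_rule n alpha)].
Proof.
have card_n : #|{: dbox alpha}| = n.
  by case/andP: halpha => _ /eqP <-; apply: card_dbox.
split.
- exact: SIT_diagram.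
- exact: SET_diagram.
- exact: SRIT_diagram.
- exact: SRET_diagram.
Qed.
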